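(* Let $U$ be an open subset of a complex Banach space $E$ and let $v$ be a weight on $U$. (i) If $H^\infty_v(U)$ has the $WH^\infty$-BPB property, then $H^\infty_{vK}(U,F)$ has the $WH^\infty$-BPB property for any complex Banach space $F$ with the property $\beta$. (ii) If $H^\infty_{v\mathrm{NA}}(U)$ is norm dense in $H^\infty_v(U)$, then $H^\infty_{vK\mathrm{NA}}(U,F)$ is norm dense in $H^\infty_{vK}(U,F)$ for any complex Banach space $F$ with the property quasi-$\beta$.
   Context: Notation: $B_X$, $S_X$ are the closed unit ball and unit sphere of a Banach space $X$; $\mathrm{Ext}(B_X)$ is the set of extreme points of $B_X$; $\mathbb{T}$ is the unit circle of $\mathbb{C}$; $w^*$ is the weak* topology. A weight on $U$ is a strictly positive continuous function on $U$. $H^\infty_v(U,F)$ is the Banach space of holomorphic mappings $f:U\to F$ with $\|f\|_v:=\sup\{v(z)\|f(z)\|: z\in U\}<\infty$; $H^\infty_v(U):=H^\infty_v(U,\mathbb{C})$. $H^\infty_{vK}(U,F)$ is the subspace of all $f\in H^\infty_v(U,F)$ such that $vf$ has relatively compact range in $F$, with the norm $\|\cdot\|_v$. $H^\infty_{v\mathrm{NA}}(U,F)$ is the set of $f\in H^\infty_v(U,F)$ for which there is $z\in U$ with $v(z)\|f(z)\|=\|f\|_v$; $H^\infty_{v\mathrm{NA}}(U):=H^\infty_{v\mathrm{NA}}(U,\mathbb{C})$; and $H^\infty_{vK\mathrm{NA}}(U,F):=H^\infty_{vK}(U,F)\cap H^\infty_{v\mathrm{NA}}(U,F)$. $G^\infty_v(U)$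 is the space of all linear functionals on $H^\infty_v(U)$ whose restriction to $B_{H^\infty_v(U)}$ is continuous for the compact-open topology; it is a closed subspace of $H^\infty_v(U)^*$, with the norm of $H^\infty_v(U)^*$. For $z\in U$, $\delta_z\in G^\infty_v(U)$ is the evaluation $\delta_z(f)=f(z)$. $WH^\infty$-BPB property: a linear subspace $A\subseteq H^\infty_v(U,F)$ (possibly the whole space; $F=\mathbb{C}$ for $H^\infty_v(U)$) has the $WH^\infty$-BPB property if for every $0<\varepsilon<1$ there is $0<\eta(\varepsilon)<\varepsilon$ such that for every $f\in S_A$, every $\lambda\in\mathbb{T}$ and every $z\in U$ with $v(z)\|f(z)\|>1-\eta(\varepsilon)$, there exist $f_0\in S_A$, $\lambda_0\in\mathbb{T}$ and $z_0\in U$ such that $v(z_0)\|f_0(z_0)\|=1$, $\|f-f_0\|_v<\varepsilon$ and $\|\lambda v(z)\delta_z-\lambda_0v(z_0)\delta_{z_0}\|<\varepsilon$ (the last norm being that of $G^\infty_v(U)$). Property $\beta$: a Banach space $F$ has the property $\beta$ if there are a set $\{(y_i,y_i^* ): i\in I\}\subseteq F\times F^*$ and a constant $0\le\rho<1$ such that (i) $\|y_i^*\|=\|y_i\|=y_i^*(y_i)=1$ for every $i\in I$; (ii) $|y_i^*(y_j)|\le\rho$ for all $i,j\in I$ with $i\ne j$; (iii) $\|y\|=\sup\{|y_i^*(y)|: i\in I\}$ for every $y\in F$. Property quasi-$\beta$: a Banach space $F$ has the property quasi-$\beta$ if there are a subset $A\subseteq S_{F^*}$, a mapping $\sigma:A\to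 S_F$ and a function $\rho:A\to\mathbb{R}$ such that (i) $y^*(\sigma(y^* ))=1$ for every $y^*\in A$; (ii) $|z^*(\sigma(y^* ))|\le\rho(y^* )<1$ for all $y^*,z^*\in A$ with $y^*\ne z^*$; (iii) for every $e^*\in\mathrm{Ext}(B_{F^*})$ there exist a set $A_{e^*}\subseteq A$ and a scalar $t\in\mathbb{T}$ such that $te^*\in\overline{A_{e^*}}^{w^*}$ and $\sup\{\rho(y^* ): y^*\in A_{e^*}\}<1$. *)

(* Defs.v *)
From HB Require Import structures.
From mathcomp Require Import all_boot all_order all_algebra.
From mathcomp Require Import complex.
From mathcomp Require Import all_classical all_reals all_analysis.

Set Implicit Arguments.
Unset Strict Implicit.
Unset Printing Implicit Defensive.

Import Order.TTheory GRing.Theory Num.Theory.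
Import numFieldNormedType.Exports.

Local Open Scope classical_set_scope.
Local Open Scope complex_scope.
Local Open Scope ring_scope.

(* The complex scalars are R[i] with R : realType; R[i]^o is R[i]
   seen as a normed space over itself. *)

(* The norm of a normedModType R[i] takes its values in R[i]; rnorm is the same
   number as an element of R (see rnormE), so that suprema can be taken in R. *)
Definition rnorm (R : realType) (V : normedModType R[i]) (x : V) : R :=
  complex.Re `|x|.

Lemma rnormE (R : realType) (V : normedModType R[i]) (x : V) :
  (rnorm x)%:C = `|x|.
Proof. by rewrite /rnorm RRe_real // ger0_real. Qed.

Definition weight (R : realType) (E : normedModType R[i]) (U : set E)
    (v : E -> R) : Prop :=
  {within U, continuous v} /\ forall z, U z -> 0 < v z.

(* Mappings U -> F are represented by total functions E -> F whose values
   outside U are irrelevant: every notion below only looks at f on the open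
   set U, and f, g represent the same mapping iff they agree on U. *)

Definition holomorphic_on (R : realType) (E F : normedModType R[i])
    (U : set E) (f : E -> F) : Prop :=
  forall z, U z -> differentiable f z.

(* sup of the empty set is 0 in R, so that wnorm is 0 when U is empty. *)
Definition wnorm (R : realType) (E F : normedModType R[i]) (U : set E)
    (v : E -> R) (f : E -> F) : R :=
  sup [set v z * rnorm (f z) | z in U].

Definition Hv (R : realType) (E F : normedModType R[i]) (U : set E)
    (v : E -> R) : set (E -> F) :=
  [set f | holomorphic_on U f /\ has_ubound [set v z * rnorm (f z) | z in U]].

Definition HvK (R : realType) (E F : normedModType R[i]) (U : set E)
    (v : E -> R) : set (E -> F) :=
  [set f | Hv U v f /\ precompact [set (v z)%:C *: f z | z in U]].

Definition HvNA (R : realType) (E F : normedModType R[i]) (U : set E)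
    (v : E -> R) : set (E -> F) :=
  [set f | Hv U v f /\
           exists2 z, U z & v z * rnorm (f z) = wnorm U v f].

Definition HvKNA (R : realType) (E F : normedModType R[i]) (U : set E)
    (v : E -> R) : set (E -> F) :=
  HvK U v `&` HvNA U v.

Definition norm_dense_in (R : realType) (E F : normedModType R[i]) (U : set E)
    (v : E -> R) (D A : set (E -> F)) : Prop :=
  forall f, A f -> forall eps : R, 0 < eps ->
    exists2 g, D g & wnorm U v (f - g) < eps.

Definition evaluation (R : realType) (E : normedModType R[i]) (z : E) :
    (E -> R[i]^o) -> R[i]^o :=
  fun f => f z.

(* The norm of the dual of Hv U v (with values in R[i]), which is also the norm
   of its closed subspace G^oo_v(U), where the evaluations live. *)
Definition Gnorm (R : realType) (E : normedModType R[i]) (U : set E)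
    (v : E -> R) (phi : (E -> R[i]^o) -> R[i]^o) : R :=
  sup [set rnorm (phi f) | f in [set f | Hv U v f /\ wnorm U v f <= 1]].

(* A is meant to be a linear subspace of Hv U v. *)
Definition WHBPB (R : realType) (E F : normedModType R[i]) (U : set E)
    (v : E -> R) (A : set (E -> F)) : Prop :=
  forall eps : R, 0 < eps < 1 ->
  exists2 eta : R, 0 < eta < eps &
  forall (f : E -> F) (lambda : R[i]) (z : E),
    A f -> wnorm U v f = 1 -> `|lambda| = 1 -> U z ->
    v z * rnorm (f z) > 1 - eta ->
  exists (f0 : E -> F) (lambda0 : R[i]) (z0 : E),
    [/\ A f0 /\ wnorm U v f0 = 1, `|lambda0| = 1 & U z0] /\
    [/\ v z0 * rnorm (f0 z0) = 1,
        wnorm U v (f - f0) < eps &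
        Gnorm U v ((lambda * (v z)%:C) *: evaluation z
                   - (lambda0 * (v z0)%:C) *: evaluation z0) < eps].

Definition dual (R : realType) (F : normedModType R[i]) : set (F -> R[i]^o) :=
  [set phi : F -> R[i]^o | linear phi /\ continuous phi].

Definition dnorm (R : realType) (F : normedModType R[i])
    (phi : F -> R[i]^o) : R :=
  sup [set rnorm (phi y) | y in [set y : F | rnorm y <= 1]].

Definition dual_ball (R : realType) (F : normedModType R[i]) :
    set (F -> R[i]^o) :=
  [set phi | dual phi /\ dnorm phi <= 1].

Definition dual_sphere (R : realType) (F : normedModType R[i]) :
    set (F -> R[i]^o) :=
  [set phi | dual phi /\ dnorm phi = 1].

Definition extreme_points (R : realType) (V : lmodType R[i]) (K : set V) :
    set V :=
  [set e | K e /\ forall (a b : V) (t : R), K a -> K b -> 0 < t < 1 ->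
     e = (1 - t)%:C *: a + t%:C *: b -> a = e /\ b = e].

Definition property_beta (R : realType) (F : normedModType R[i]) : Prop :=
  exists (I : Type) (y : I -> F) (ys : I -> F -> R[i]^o) (rho : R),
  [/\ 0 <= rho < 1,
      forall i, [/\ dual (ys i), dnorm (ys i) = 1, rnorm (y i) = 1
                  & ys i (y i) = 1],
      forall i j, i <> j -> rnorm (ys i (y j)) <= rho &
      forall x : F, rnorm x = sup [set rnorm (ys i x) | i in [set: I]]].

(* The weak* topology of the dual is the one induced by the pointwise topology
   {ptws F -> R[i]^o}, so a functional is in the weak* closure of a set of
   functionals iff it is in its pointwise closure. *)
Definition property_quasi_beta (R : realType) (F : normedModType R[i]) : Prop :=
  exists (A : set (F -> R[i]^o)) (sigma : (F -> R[i]^o) -> F)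
         (rho : (F -> R[i]^o) -> R),
  [/\ A `<=` dual_sphere (F:=F) /\ (forall ys, A ys -> rnorm (sigma ys) = 1),
      forall ys, A ys -> ys (sigma ys) = 1,
      forall ys zs, A ys -> A zs -> ys <> zs ->
        rnorm (zs (sigma ys)) <= rho ys /\ rho ys < 1 &
      forall es, extreme_points (dual_ball (F:=F)) es ->
        exists (Ae : set (F -> R[i]^o)) (t : R[i]),
          [/\ Ae `<=` A, `|t| = 1,
              closure (Ae : set {ptws F -> R[i]^o}) (t *: es) &
              sup [set rho ys | ys in Ae] < 1]].

(* Main.v *)
(* Choose a functional phi of the family given by beta (resp. quasi-beta) that
   almost norms v(z) f(z) (resp. a point k of maximal norm in the compact
   closure of (v f)(U)), apply the scalar hypothesis to g = phi o f to get a
   nearby g0, and perturb f to f + ((1 + e) g0 - g) y, where phi y = 1.  The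
   image under phi is (1 + e) g0; since the other functionals of the family are
   at most rho < 1 on y, they see less of the change than phi, so for a suitable
   small e the new norm is attained wherever g0 attains its norm.  For
   quasi-beta one needs an extreme point of the dual ball norming k.  It is
   found without weak* compactness: replacing a sublinear functional by one of
   its directional derivatives selects an exposed subface of the set of linear
   functionals below it, so a minimal sublinear functional among the support
   functions of faces is linear and extreme. *)

From HB Require Import structures.
Require Import Defs.
From mathcomp Require Import all_boot all_order all_algebra.
From mathcomp Require Import complex ring lra.
From mathcomp Require Import all_classical all_reals all_analysis.

Import Order.TTheory GRing.Theory Num.Theory.
Import numFieldNormedType.Exports.

Local Open Scope classical_set_scope.
Local Open Scope ring_scope.

(** * The norm with real values *)

Lemma rnormCE {R : realType} (a : R[i]) : (rnorm (a : R[i]^o))%:C%C = `|a|.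
Proof. exact: (rnormE (a : R[i]^o)). Qed.

Section rnorm.
Context {R : realType} {V : normedModType R[i]}.
Implicit Types (x y : V) (a : R[i]) (c : R).

Lemma rnorm_ge0 x : 0 <= rnorm x.
Proof. by rewrite -lecR rnormE rmorph0 normr_ge0. Qed.

Lemma rnormD x y : rnorm (x + y) <= rnorm x + rnorm y.
Proof. by rewrite -lecR rmorphD/= !rnormE ler_normD. Qed.

Lemma rnormN x : rnorm (- x) = rnorm x.
Proof. by rewrite /rnorm normrN. Qed.

Lemma rnorm_eq0 x : rnorm x = 0 -> x = 0.
Proof. by move=> h; apply/eqP; rewrite -normr_eq0 -rnormE h. Qed.

Lemma rnorm0 : rnorm (0 : V) = 0.
Proof. by rewrite /rnorm normr0. Qed.

Lemma rnormZ a x : rnorm (a *: x) = rnorm (a : R[i]^o) * rnorm x.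
Proof. by apply: complexI; rewrite rmorphM/= !rnormE normrZ. Qed.

Lemma rnorm_real c : rnorm (c%:C%C : R[i]^o) = `|c|.
Proof.
apply: complexI; rewrite rnormE normc_def/= expr0n/= addr0 sqrtr_sqr//.
Qed.

Lemma rnormZr c x : rnorm (c%:C%C *: x) = `|c| * rnorm x.
Proof. by rewrite rnormZ rnorm_real. Qed.

Lemma Re_le_rnorm a : complex.Re a <= rnorm (a : R[i]^o).
Proof.
apply: (le_trans (ler_norm _)); rewrite -lecR rnormE; exact: normc_ge_Re.
Qed.

Lemma rnorm_unit a : `|a| = 1 -> rnorm (a : R[i]^o) = 1.
Proof. by move=> h; apply: complexI; rewrite rnormE. Qed.

End rnorm.

(** * Sublinear functionals and extreme points of the real dual ball *)

Section gauge.
Context {R : realType} {F : normedModType R[i]}.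
Implicit Types (x y : F) (p q a b : F -> R).

(** Homogeneity is stated as an inequality; applying it to [c] and to [c^-1] gives equality. *)
Definition sublinear p :=
  (forall x y, p (x + y) <= p x + p y) /\
  (forall (c : R) x, 0 < c -> p (c%:C%C *: x) <= c * p x).

(** Linearity is over the reals. The one-sided bound, taken at [x] and [- x], bounds the modulus of
    [a x] by [rnorm x]. *)
Definition real_ball : set (F -> R) :=
  [set a | [/\ forall x y, a (x + y) = a x + a y,
               forall (c : R) x, a (c%:C%C *: x) = c * a x &
               forall x, a x <= rnorm x]].

(* p is the support function of an extremal subset of the real dual ball *)
Definition face_gauge p :=
  [/\ sublinear p, forall x, p x <= rnorm x &
    forall a b (t : R), real_ball a -> real_ball b -> 0 < t < 1 ->
      (forall x, (1 - t) * a x + t * b x <= p x) -> forall x, a x <= p x].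

(* one-sided derivative of p at y in the direction x *)
Definition gauge_at p y x :=
  inf [set p (x + s%:C%C *: y) - s * p y | s in [set s : R | 0 <= s]].

Lemma sublinear0 p : sublinear p -> p 0 = 0.
Proof.
move=> [pD pZ]; have := pD 0 0; have := pZ (2^-1) 0.
rewrite scaler0 addr0 => /(_ _)/wrap[]; first by lra. lra.
Qed.

Lemma sublinearZ p (c : R) x : sublinear p -> 0 <= c ->
  p (c%:C%C *: x) = c * p x.
Proof.
move=> sp; rewrite le_eqVlt => /predU1P[<-|c0].
  by rewrite scale0r mul0r sublinear0.
apply/eqP; rewrite eq_le sp.2//= -ler_pdivlMl//.
rewrite (le_trans _ (sp.2 c^-1 _ _)) ?invr_gt0//.
by rewrite scalerA -rmorphM/= mulVf ?gt_eqF// scale1r.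
Qed.

Lemma sublinearN p x : sublinear p -> - p (- x) <= p x.
Proof.
by move=> sp; have := sp.1 x (- x); rewrite subrr sublinear0// -subr_ge0; lra.
Qed.

(** The bound does not depend on [s], so the infimum in [gauge_at] is taken over a set bounded
    below. *)
Lemma gauge_at_lbound p x y (s : R) : sublinear p -> 0 <= s ->
  - p (- x) <= p (x + s%:C%C *: y) - s * p y.
Proof.
move=> sp s0; rewrite -sublinearZ//.
have := sp.1 (x + s%:C%C *: y) (- x); rewrite addrAC subrr add0r; lra.
Qed.

Lemma gauge_at_le p x y (s : R) : sublinear p -> 0 <= s ->
  gauge_at p y x <= p (x + s%:C%C *: y) - s * p y.
Proof.
move=> sp s0; apply: ge_inf; last by exists s.
by exists (- p (- x)) => _ [u u0 <-]; exact: gauge_at_lbound.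
Qed.

Lemma gauge_at_ge p x y (c : R) :
  (forall s : R, 0 <= s -> c <= p (x + s%:C%C *: y) - s * p y) ->
  c <= gauge_at p y x.
Proof.
move=> h; apply: lb_le_inf => [|_ [u u0 <-]]; last exact: h.
by exists (p (x + 0%:C%C *: y) - 0 * p y), 0 => /=.
Qed.

Lemma gauge_at_le_id p x y : sublinear p -> gauge_at p y x <= p x.
Proof.
move=> sp; apply: (le_trans (gauge_at_le p x y 0 sp _)) => //.
by rewrite scale0r addr0 mul0r subr0.
Qed.

(** For sums, the parameters [s] for [x] and [u] for [x'] combine to [s + u]; for multiples, [s] is
    rescaled to [c * s]. *)
Lemma sublinear_gauge_at p y : sublinear p -> sublinear (gauge_at p y).
Proof.
move=> sp; split=> [x x'|c x c0].
- suff h u (u0 : 0 <= u) : gauge_at p y (x + x') - (p (x' + u%:C%C *: y) - u * p y)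
                           <= gauge_at p y x.
    rewrite -lerBlDl; apply: gauge_at_ge => u u0.
    by have := h u u0; lra.
  apply: gauge_at_ge => s s0.
  have := gauge_at_le p (x + x') y (s + u) sp (addr_ge0 s0 u0).
  rewrite rmorphD/= scalerDl addrACA.
  by have := sp.1 (x + s%:C%C *: y) (x' + u%:C%C *: y); lra.
- rewrite -ler_pdivrMl//; apply: gauge_at_ge => s s0.
  rewrite ler_pdivrMl//.
  have cs0 : 0 <= c * s by rewrite mulr_ge0// ltW.
  apply: (le_trans (gauge_at_le p _ y (c * s) sp cs0)).
  by rewrite rmorphM/= -scalerA -scalerDr (sublinearZ _ _ _ sp (ltW c0)) mulrBr mulrA.
Qed.

(** A mean of [a] and [b] below the derivative is also below [p], hence so are [a] and [b]. It must
    reach [p y] at [y], which forces [a y = p y]; then [a x = a (x + s y) - s a y] is at most every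
    term of the infimum. *)
Lemma face_gauge_at p y : face_gauge p -> face_gauge (gauge_at p y).
Proof.
move=> [sp pn fp]; split; first exact: sublinear_gauge_at.
  by move=> x; exact: le_trans (gauge_at_le_id p x y sp) (pn x).
move=> a b t ra rb t01 h.
have hp x : (1 - t) * a x + t * b x <= p x.
  exact: le_trans (h x) (gauge_at_le_id p x y sp).
have ap := fp a b t ra rb t01 hp.
have bp : forall x, b x <= p x.
  apply: (fp b a (1 - t)) => //; first by lra.
  by move=> x; have := hp x; lra.
have [aD aZ _] := ra; have [bD bZ _] := rb.
(* The term [s = 1] at [- y] shows that the mean is at least [p y] at [y], while [b y <= p y]. *)
have ay : p y <= a y.
  have := h (- y); have := gauge_at_le p (- y) y 1 sp ler01.
  rewrite scale1r addNr sublinear0// mul1r sub0r.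
  have aN : a (- y) = - a y by have := aZ (-1) y; rewrite rmorphN1 scaleN1r; lra.
  have bN : b (- y) = - b y by have := bZ (-1) y; rewrite rmorphN1 scaleN1r; lra.
  rewrite aN bN; have := bp y; case/andP: t01 => t0 t1 byp H1 H2.
  rewrite -(ler_pM2l (x := 1 - t)) ?subr_gt0//.
  have := ler_wpM2l (ltW t0) byp; lra.
move=> x; apply: gauge_at_ge => s s0.
have := ap (x + s%:C%C *: y); rewrite aD aZ.
by have := ler_wpM2l s0 ay; lra.
Qed.

Lemma face_gauge_rnorm : face_gauge (@rnorm R F).
Proof.
split=> //; last by move=> a b t [].
split=> [x y|c x c0]; first exact: rnormD.
by rewrite rnormZr gtr0_norm.
Qed.

(** Zorn's lemma for the reversed pointwise order: the pointwise infimum of a nonempty chain is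
    again a face gauge. *)
Lemma minimal_face_gauge p0 : face_gauge p0 -> exists2 p,
  face_gauge p /\ (forall x, p x <= p0 x) &
  forall q, face_gauge q -> (forall x, q x <= p x) -> q = p.
Proof.
move=> fp0.
pose T := {p | face_gauge p /\ forall x, p x <= p0 x}.
pose le (p q : T) := `[< forall x, sval q x <= sval p x >].
have [||||[p pP] pmin] := @Zorn T le.
- by move=> p; apply/asboolP.
- move=> q p r /asboolP pq /asboolP qr; apply/asboolP => x.
  exact: le_trans (qr x) (pq x).
- move=> [p pP] [q qP] /asboolP/= pq /asboolP/= qp; apply/eq_exist.
  by apply/funext => x; apply/eqP; rewrite eq_le pq qp.
- move=> C totC; have [[q0 Cq0]|C0] := pselect (C !=set0); last first.
    exists (exist _ p0 (conj fp0 (fun x => lexx _))) => s Cs.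
    by exfalso; apply: C0; exists s.
  pose m x := inf [set sval q x | q in C].
  have m_le (q : T) x : C q -> m x <= sval q x.
    move=> Cq; apply: ge_inf; last by exists q.
    exists (- rnorm x) => _ [r Cr <-].
    have [[sr rn _] _] := svalP r.
    by apply: le_trans (sublinearN _ x sr); rewrite lerN2 -rnormN.
  have m_ge x c : (forall q : T, C q -> c <= sval q x) -> c <= m x.
    move=> h; apply: lb_le_inf; first by exists (sval q0 x), q0.
    by move=> _ [r Cr <-]; exact: h.
  have fm : face_gauge m.
    split.
    + split=> [x y|c x c0].
      * rewrite -lerBlDr; apply: (m_ge _ _) => q Cq.
        rewrite lerBlDr -lerBlDl; apply: (m_ge _ _) => r Cr; rewrite lerBlDl.
        have [[[sq _] _ _] _] := svalP q; have [[[sr _] _ _] _] := svalP r.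
        (* The smaller of the two members of the chain serves for both [x] and [y]. *)
        have [/asboolP qr|/asboolP rq] := totC _ _ Cq Cr.
          apply: (le_trans (m_le _ _ Cr)); apply: (le_trans (sr _ _)).
          by rewrite lerD2r.
        apply: (le_trans (m_le _ _ Cq)); apply: (le_trans (sq _ _)).
        by rewrite lerD2l.
      * rewrite -ler_pdivrMl//; apply: (m_ge _ _) => q Cq; rewrite ler_pdivrMl//.
        have [[[_ sq] _ _] _] := svalP q.
        exact: le_trans (m_le _ _ Cq) (sq _ _ c0).
    + move=> x; have [[_ qn _] _] := svalP q0.
      exact: le_trans (m_le _ x Cq0) (qn x).
    + move=> a b t ra rb t01 h x; apply: (m_ge _ _) => q Cq.
      have [[_ _ fq] _] := svalP q; apply: (fq a b t) => // z.
      exact: le_trans (h z) (m_le _ _ Cq).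
  have mp0 x : m x <= p0 x.
    by have [_ qp] := svalP q0; exact: le_trans (m_le _ x Cq0) (qp x).
  exists (exist _ m (conj fm mp0)) => q Cq; apply/asboolP => x /=.
  exact: m_le.
exists p => // q fq qp; have [_ pp0] := pP.
have qp0 x : q x <= p0 x by exact: le_trans (qp x) (pp0 x).
have /(_ _)/wrap[] := pmin (exist _ q (conj fq qp0)); first exact/asboolP.
by move=> /(congr1 sval).
Qed.

(** Minimality forces [gauge_at p y = p] for every [y]; the term [s = 1] then reads
    [p x <= p (x + y) - p y], which is superadditivity. *)
Lemma minimal_face_gauge_linear p : face_gauge p ->
  (forall q, face_gauge q -> (forall x, q x <= p x) -> q = p) -> real_ball p.
Proof.
move=> fp pmin; have [sp pn _] := fp.
have pE y : gauge_at p y = p.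
  by apply: pmin; [exact: face_gauge_at|move=> x; exact: gauge_at_le_id].
have pD x y : p (x + y) = p x + p y.
  apply/eqP; rewrite eq_le sp.1/=.
  by have := gauge_at_le p x y 1 sp ler01; rewrite pE scale1r mul1r; lra.
split=> // c x; have [c0|c0] := leP 0 c; first exact: sublinearZ.
have : p (- c%:C%C *: x) = - c * p x.
  by rewrite -rmorphN sublinearZ// oppr_ge0 ltW.
have := pD (c%:C%C *: x) (- c%:C%C *: x).
by rewrite scaleNr subrr sublinear0//; lra.
Qed.

(** Take [p] minimal below the derivative of the norm at [k]. The term [s = 1] at [- k] gives
    [p (- k) <= - rnorm k]. In a decomposition of [p] the face property gives [a <= p], hence
    equality, both being odd. *)
Lemma extreme_real_functional (k : F) : exists p, [/\ real_ball p,
  rnorm k <= p k &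
  forall a b (t : R), real_ball a -> real_ball b -> 0 < t < 1 ->
    (forall x, p x = (1 - t) * a x + t * b x) -> a = p].
Proof.
have fk := face_gauge_at _ k face_gauge_rnorm.
have [p [fp pk] pmin] := minimal_face_gauge _ fk.
have rp := minimal_face_gauge_linear _ fp pmin; have [pD pZ _] := rp.
have pN x : p (- x) = - p x.
  by have := pZ (-1) x; rewrite rmorphN1 scaleN1r mulN1r.
exists p; split=> //.
  have [sn _ _] := face_gauge_rnorm.
  have := pk (- k); have := gauge_at_le _ (- k) k 1 sn ler01.
  by rewrite scale1r addNr rnorm0 pN; lra.
move=> a b t ra rb t01 pE.
have [_ _ /(_ a b t ra rb t01)] := fp => /(_ _)/wrap[].
  by move=> x; rewrite pE.
move=> ap; have [aD aZ _] := ra.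
have aN x : a (- x) = - a x.
  by have := aZ (-1) x; rewrite rmorphN1 scaleN1r mulN1r.
apply/funext => x; apply/eqP; rewrite eq_le ap/=.
by have := ap (- x); rewrite aN pN lerN2.
Qed.

End gauge.

(** * The complex dual ball and its norming extreme points *)

Section dual.
Context {R : realType} {F : normedModType R[i]}.
Implicit Types (x y k : F) (phi : F -> R[i]^o).

Lemma linear_fct0 phi : linear phi -> phi 0 = 0.
Proof. by move=> /(_ (-1) 0 0); rewrite scaler0 addr0 scaleN1r addNr. Qed.

Lemma linear_fctZ phi a x : linear phi -> phi (a *: x) = a *: phi x.
Proof.
by move=> l; have := l a x 0; rewrite addr0 linear_fct0// addr0.
Qed.

Lemma linear_fctD phi x y : linear phi -> phi (x + y) = phi x + phi y.
Proof. by move=> l; have := l 1 x y; rewrite !scale1r. Qed.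

Lemma linear_contraction_dual_ball phi : linear phi ->
  (forall x, rnorm (phi x) <= rnorm x) -> dual_ball phi.
Proof.
move=> lphi phin.
pose f : {linear F -> R[i]^o} := HB.pack phi
  (GRing.isLinear.Build _ _ _ _ phi lphi).
split; first split=> //.
  have /linear_bounded_continuous : bounded_near f (nbhs 0) => //.
  apply/linear_boundedP; exists 1; split; first exact: real1.
  move=> r r1 x; apply: (@le_trans _ _ `|x|).
    by rewrite -!rnormE lecR; exact: phin.
  by rewrite ler_peMl// ltW.
apply: ge_sup; first by exists (rnorm (phi 0)), 0 => //=; rewrite rnorm0.
by move=> _ [x /= x1 <-]; exact: le_trans (phin x) x1.
Qed.

Lemma dual_has_ubound phi : dual phi ->
  has_ubound [set rnorm (phi x) | x in [set x : F | rnorm x <= 1]].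
Proof.
move=> [lphi cphi].
pose f : {linear F -> R[i]^o} := HB.pack phi
  (GRing.isLinear.Build _ _ _ _ phi lphi).
have /linear_boundedP[M [Mreal HM]] : bounded_near f (nbhs 0).
  exact/linear_bounded_continuous.
have M1 : M < `|M| + 1 by rewrite (le_lt_trans (real_ler_norm Mreal))// ltrDl.
have cE : `|M| + 1 = (complex.Re (`|M| + 1))%:C%C.
  by rewrite RRe_real// realD ?normr_real ?real1.
have c0 : 0 <= complex.Re (`|M| + 1) by rewrite -lecR -cE rmorph0 addr_ge0.
exists (complex.Re (`|M| + 1)) => _ [x /= x1 <-].
have := HM _ M1 x => /=; rewrite cE -(rnormE (phi x)) -(rnormE x) -rmorphM/= lecR.
by move=> /le_trans; apply; rewrite ler_piMr.
Qed.

Lemma dual_ball_le phi x : dual_ball phi -> rnorm (phi x) <= rnorm x.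
Proof.
move=> [dphi phi1]; have [lphi _] := dphi.
have [x0|x0] := eqVneq (rnorm x) 0.
  by rewrite (rnorm_eq0 _ x0) linear_fct0// !rnorm0.
have xp : 0 < rnorm x by rewrite lt_def x0 rnorm_ge0.
suff : rnorm (phi ((rnorm x)^-1%:C%C *: x)) <= 1.
  by rewrite linear_fctZ// rnormZr gtr0_norm ?invr_gt0// ler_pdivrMl// mulr1.
apply: le_trans phi1; apply: ub_le_sup; first exact: dual_has_ubound.
by exists ((rnorm x)^-1%:C%C *: x); rewrite //= rnormZr gtr0_norm ?invr_gt0// mulVf.
Qed.

Lemma dual_ball_Re phi : dual_ball phi ->
  real_ball (fun x => complex.Re (phi x)).
Proof.
move=> bphi; have [[lphi _] _] := bphi; split.
- by move=> x y; rewrite linear_fctD// raddfD.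
- by move=> c x; rewrite linear_fctZ//=; case: (phi x) => u w /=; rewrite mul0r subr0.
- by move=> x; exact: le_trans (Re_le_rnorm _) (dual_ball_le _ _ bphi).
Qed.

(** For real-linear [p], the only complex-linear functional with real part [p]. *)
Definition complexify (p : F -> R) : F -> R[i]^o :=
  fun x => Complex (p x) (- p ('i%C *: x)).

Lemma scale_ReIm (a : R[i]) x :
  a *: x = (complex.Re a)%:C%C *: x + (complex.Im a)%:C%C *: ('i%C *: x).
Proof. by rewrite scalerA -scalerDl [X in _ + X]mulrC -complexE. Qed.

Lemma linear_complexify p : real_ball p -> linear (complexify p).
Proof.
move=> [pD pZ _] a x y; rewrite /complexify.
have iE : 'i%C *: ('i%C *: x) = (-1)%:C%C *: x.
  by rewrite scalerA rmorphN1 -expr2 sqr_i.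
have aix : a *: ('i%C *: x) = 'i%C *: (a *: x) by rewrite !scalerA mulrC.
rewrite scalerDr !pD -aix scale_ReIm [a *: ('i%C *: x)]scale_ReIm iE !pD !pZ.
case: a {aix} => u w /=.
by apply/eqP; rewrite eq_complex /=; apply/andP; split; apply/eqP; ring.
Qed.

(** Rotating [x] by a unimodular [u] turns the value at [x] into its modulus, which is then a value
    of [p]. *)
Lemma dual_ball_complexify p : real_ball p -> dual_ball (complexify p).
Proof.
move=> rp; have lp := linear_complexify _ rp; have [_ _ pn] := rp.
apply: linear_contraction_dual_ball => // x.
set w := complexify p x.
have [->|w0] := eqVneq w 0; first by rewrite rnorm0 rnorm_ge0.
have nw : rnorm w != 0 by apply: contra w0 => /eqP/rnorm_eq0->.
pose u : R[i] := (rnorm w)^-1%:C%C * w^*%C.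
have uw : complexify p (u *: x) = (rnorm w)%:C%C.
  rewrite linear_fctZ// -/w /GRing.scale/= /u -mulrA [X in _ * X]mulrC.
  by rewrite -sqr_normc -rnormCE -rmorphXn -rmorphM/= expr2 mulKf.
have un : rnorm (u : R[i]^o) = 1.
  apply: complexI; rewrite rnormE normrM.
  have -> : `|w^*%C| = `|w| by case: (w) => a b; rewrite !normc_def /= sqrrN.
  rewrite -!rnormCE rnorm_real -rmorphM/= ger0_norm ?mulVf//.
  by rewrite invr_ge0 rnorm_ge0.
have := pn (u *: x); rewrite rnormZ un mul1r.
by have /(congr1 (@complex.Re _))/= -> := uw.
Qed.

(* Hahn-Banach together with Krein-Milman on the face of the functionals of
   the dual ball that attain their norm at k *)
Lemma extreme_norming k : exists2 es, extreme_points (dual_ball (F := F)) es &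
  rnorm k <= rnorm (es k).
Proof.
have [p [rp pk pext]] := extreme_real_functional k.
exists (complexify p); last first.
  by apply: (le_trans pk); exact: (Re_le_rnorm (complexify p k)).
split; first exact: dual_ball_complexify.
(* Exchanging [a], [t] with [b], [1 - t] shows that it is enough to identify [a]. *)
suff h (a b : F -> R[i]^o) (t : R) : dual_ball a -> dual_ball b -> 0 < t < 1 ->
    complexify p = (1 - t)%:C%C *: a + t%:C%C *: b -> a = complexify p.
  move=> a b t Ka Kb t01 e; split; first exact: h e.
  apply: (h b a (1 - t)) => //; first by lra.
  by rewrite e addrC; congr (_%:C%C *: _ + _); lra.
move=> Ka Kb t01 e.
(* Taking real parts decomposes [p] in the real ball; extremality there fixes the real part of [a],
   hence [a]. *)
have aE : (fun x => complex.Re (a x)) = p.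
  apply: (pext _ (fun x => complex.Re (b x)) t) => //; try exact: dual_ball_Re.
  move=> x; have /(congr1 (@complex.Re _)) := congr1 (@^~ x) e.
  rewrite /= => ->; rewrite !fctE/=.
  by case: (a x) => a1 a2; case: (b x) => b1 b2 /=; ring.
have [[la _] _] := Ka.
apply/funext => x; rewrite /complexify -aE linear_fctZ//.
by case: (a x) => a1 a2 /=; congr Complex; ring.
Qed.

End dual.

(** * Relatively compact sets *)

Section precompact.
Context {R : realType}.

Lemma real_complex_continuous :
  continuous (fun c : R => c%:C%C : R[i]^o).
Proof.
move=> c; apply/cvgrPdist_lt => e e0.
have eE : e = (complex.Re e)%:C%C by rewrite RRe_real// gtr0_real.
have re0 : 0 < complex.Re e by rewrite -ltcR -eE rmorph0.
near=> d.
have -> : c%:C%C - d%:C%C = (c - d)%:C%C :> R[i]^o by rewrite rmorphB.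
rewrite -rnormE rnorm_real eE ltcR.
by near: d; apply: (cvgr_dist_lt (fun x => x)).
Unshelve. all: by end_near. Qed.

(** Such a set lies in the continuous image of a compact square of real and imaginary parts. *)
Lemma bounded_precompact (M : R) (A : set R[i]^o) :
  (forall a, A a -> rnorm a <= M) -> precompact A.
Proof.
move=> AM.
pose I : set R := `[- M, M]%classic.
pose f (q : R * R) : R[i]^o := q.1%:C%C + 'i%C *: (q.2%:C%C : R[i]^o).
have cf : continuous f.
  move=> q; apply: cvgD.
    apply: (continuous_comp (f := fst) (g := fun c : R => c%:C%C : R[i]^o)).
      exact: cvg_fst.
    exact: real_complex_continuous.
  apply: cvgZr.
  apply: (continuous_comp (f := snd) (g := fun c : R => c%:C%C : R[i]^o)).
      exact: cvg_snd.
    exact: real_complex_continuous.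
have : compact (f @` (I `*` I)).
  apply: continuous_compact; first exact: continuous_subspaceT.
  by apply: compact_setX; exact: segment_compact.
move=> /(compact_precompact (@norm_hausdorff _ _)); apply: precompact_subset.
move=> a /AM aM; exists (complex.Re a, complex.Im a); last first.
  by rewrite /f /= /GRing.scale/= -complexE.
have rM (b : R[i]) : rnorm (b : R[i]^o) <= M -> `|complex.Re b| <= M.
  by move=> h; rewrite -lecR (le_trans (normc_ge_Re b))// -rnormCE lecR.
split; rewrite /I /= in_itv /= -ler_norml; first exact: rM.
have -> : complex.Im a = complex.Re (- 'i%C * a).
  by case: a {aM} => x y /=; ring.
have ni : `|- 'i%C : R[i]| = 1.
  by rewrite normrN normc_def/= expr0n expr1n/= add0r sqrtr1.
by apply: rM; rewrite (rnormZ (- 'i%C) (a : R[i]^o)) rnorm_unit// mul1r.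
Qed.

Lemma precompactD (F : normedModType R[i]) (A B : set F) :
  precompact A -> precompact B ->
  precompact [set x | exists a b, [/\ A a, B b & x = a + b]].
Proof.
rewrite !precompactE => cA cB.
have : compact ((fun q : F * F => q.1 + q.2) @` (closure A `*` closure B)).
  apply: continuous_compact; last exact: compact_setX.
  by apply: continuous_subspaceT => q; exact: add_continuous.
move=> /(compact_precompact (@norm_hausdorff _ _)).
rewrite -precompactE; apply: precompact_subset => x [a [b [Aa Bb ->]]].
by exists (a, b) => //; split; exact: subset_closure.
Qed.

Lemma precompactZ (F : normedModType R[i]) (c : R[i]) (A : set F) :
  precompact A -> precompact [set c *: x | x in A].
Proof.
rewrite precompactE => cA.
have : compact ((fun x : F => c *: x) @` closure A).
  apply: continuous_compact => //; apply: continuous_subspaceT.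
  exact: scaler_continuous.
move=> /(compact_precompact (@norm_hausdorff _ _)).
apply: precompact_subset => _ [a Aa <-].
by exists a => //; exact: subset_closure.
Qed.

Lemma precompact_scale_vec (F : normedModType R[i]) (y : F) (A : set R[i]^o) :
  precompact A -> precompact [set a *: y | a in A].
Proof.
rewrite precompactE => cA.
have : compact ((fun a : R[i]^o => a *: y) @` closure A).
  apply: continuous_compact => //; apply: continuous_subspaceT.
  exact: scalel_continuous.
move=> /(compact_precompact (@norm_hausdorff _ _)).
apply: precompact_subset => _ [a Aa <-].
by exists a => //; exact: subset_closure.
Qed.

End precompact.

(** * Weighted spaces of holomorphic mappings *)

Section weighted.
Context {R : realType} {E F : normedModType R[i]} {U : set E} {v : E -> R}.
Hypothesis vpos : forall z, U z -> 0 < v z.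
Implicit Types (f g : E -> F) (h : E -> R[i]^o).

(** [0 <= C] covers the case of empty [U], where the supremum is 0. *)
Lemma wnorm_le {F' : normedModType R[i]} (f : E -> F') (C : R) : 0 <= C ->
  (forall z, U z -> v z * rnorm (f z) <= C) -> wnorm U v f <= C.
Proof.
move=> C0 fC; rewrite /wnorm.
have [[z Uz]|U0] := pselect (U !=set0); last first.
  have -> : U = set0 by apply/eqP/negP => /negP/set0P.
  by rewrite image_set0 sup0.
apply: ge_sup; first by exists (v z * rnorm (f z)), z.
by move=> _ [w Uw <-]; exact: fC.
Qed.

Lemma le_wnorm {F' : normedModType R[i]} (f : E -> F') z : Hv U v f -> U z ->
  v z * rnorm (f z) <= wnorm U v f.
Proof. by move=> [_ bf] Uz; apply: ub_le_sup => //; exists z. Qed.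

Lemma wnorm_eq {F' : normedModType R[i]} (f : E -> F') z : Hv U v f -> U z ->
  (forall w, U w -> v w * rnorm (f w) <= v z * rnorm (f z)) ->
  wnorm U v f = v z * rnorm (f z).
Proof.
move=> Hf Uz fz; apply/eqP; rewrite eq_le le_wnorm// andbT.
by apply: wnorm_le => //; rewrite mulr_ge0 ?rnorm_ge0// ltW// vpos.
Qed.

Lemma wnorm_ge0 {F' : normedModType R[i]} (f : E -> F') : Hv U v f ->
  0 <= wnorm U v f.
Proof.
move=> Hf; have [[z Uz]|U0] := pselect (U !=set0).
  by apply: le_trans (le_wnorm _ _ Hf Uz); rewrite mulr_ge0 ?rnorm_ge0// ltW// vpos.
rewrite /wnorm; have -> : U = set0 by apply/eqP/negP => /negP/set0P.
by rewrite image_set0 sup0.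
Qed.

Lemma HvD {F' : normedModType R[i]} (f g : E -> F') : Hv U v f -> Hv U v g ->
  Hv U v (f + g).
Proof.
move=> Hf Hg; split=> [z Uz|].
  by apply: differentiableD; [exact: Hf.1|exact: Hg.1].
exists (wnorm U v f + wnorm U v g) => _ [z Uz <-].
rewrite (@le_trans _ _ (v z * (rnorm (f z) + rnorm (g z))))//.
  by rewrite ler_pM2l ?vpos//; exact: rnormD.
by rewrite mulrDr lerD// le_wnorm.
Qed.

Lemma HvZ {F' : normedModType R[i]} (c : R[i]) (f : E -> F') : Hv U v f ->
  Hv U v (c *: f).
Proof.
move=> Hf; split=> [z Uz|].
  by apply: differentiableZ; exact: Hf.1.
exists (rnorm (c : R[i]^o) * wnorm U v f) => _ [z Uz <-].
rewrite [X in rnorm X]/(c *: f z) rnormZ mulrCA ler_wpM2l ?rnorm_ge0//.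
exact: le_wnorm.
Qed.

Lemma HvB {F' : normedModType R[i]} (f g : E -> F') : Hv U v f -> Hv U v g ->
  Hv U v (f - g).
Proof. by move=> Hf Hg; rewrite -scaleN1r; apply: HvD => //; exact: HvZ. Qed.

Lemma wnormD_le {F' : normedModType R[i]} (f g : E -> F') :
  Hv U v f -> Hv U v g -> wnorm U v (f + g) <= wnorm U v f + wnorm U v g.
Proof.
move=> Hf Hg; apply: wnorm_le => [|z Uz].
  by rewrite addr_ge0// wnorm_ge0.
rewrite (@le_trans _ _ (v z * (rnorm (f z) + rnorm (g z))))//.
  by rewrite ler_pM2l ?vpos//; exact: rnormD.
by rewrite mulrDr lerD// le_wnorm.
Qed.

Lemma wnormZ_le {F' : normedModType R[i]} (c : R) (f : E -> F') :
  Hv U v f -> wnorm U v (c%:C%C *: f) <= `|c| * wnorm U v f.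
Proof.
move=> Hf; apply: wnorm_le => [|z Uz]; first by rewrite mulr_ge0// wnorm_ge0.
rewrite [X in rnorm X]/(c%:C%C *: f z) rnormZr mulrCA ler_wpM2l//.
exact: le_wnorm.
Qed.

Lemma wnormZ {F' : normedModType R[i]} (c : R) (f : E -> F') : 0 < c ->
  Hv U v f -> wnorm U v (c%:C%C *: f) = c * wnorm U v f.
Proof.
move=> c0 Hf; apply/eqP; rewrite eq_le -[X in _ <= X * _](gtr0_norm c0).
rewrite wnormZ_le//= -ler_pdivlMl//.
have {1}-> : f = c^-1%:C%C *: (c%:C%C *: f).
  by rewrite scalerA -rmorphM/= mulVf ?gt_eqF// scale1r.
rewrite -[X in _ <= X * _]gtr0_norm ?invr_gt0//.
by apply: wnormZ_le; exact: HvZ.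
Qed.

Lemma wnormN {F' : normedModType R[i]} (f : E -> F') :
  wnorm U v (- f) = wnorm U v f.
Proof.
rewrite /wnorm; congr sup; apply: eq_imagel => z Uz.
by rewrite [X in rnorm X]/(- f z) rnormN.
Qed.

Lemma Hv_comp_dual (phi : F -> R[i]^o) f : dual_ball phi -> Hv U v f ->
  Hv U v (phi \o f) /\ wnorm U v (phi \o f) <= wnorm U v f.
Proof.
move=> bphi Hf; have [[lphi cphi] _] := bphi.
have le z : U z -> v z * rnorm (phi (f z)) <= wnorm U v f.
  move=> Uz; apply: le_trans (le_wnorm _ _ Hf Uz).
  by rewrite ler_pM2l ?vpos//; exact: dual_ball_le.
split; last by apply: wnorm_le => //; exact: wnorm_ge0.
split=> [z Uz|]; last by exists (wnorm U v f) => _ [z Uz <-]; exact: le.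
pose l : {linear F -> R[i]^o} := HB.pack phi
  (GRing.isLinear.Build _ _ _ _ phi lphi).
apply: differentiable_comp; first exact: Hf.1.
exact: (@linear_differentiable _ _ _ l).
Qed.

Lemma HvZl h (y : F) : Hv U v h -> Hv U v (fun z => h z *: y).
Proof.
move=> Hh; split=> [z Uz|].
  by apply: differentiableZl; exact: Hh.1.
exists (wnorm U v h * rnorm y) => _ [z Uz <-].
by rewrite rnormZ mulrA ler_wpM2r ?rnorm_ge0// le_wnorm.
Qed.

Lemma HvKZ (c : R[i]) f : HvK U v f -> HvK U v (c *: f).
Proof.
move=> [Hf cf]; split; first exact: HvZ.
apply: precompact_subset (precompactZ _ c _ cf) => _ [z Uz <-].
exists ((v z)%:C%C *: f z); first by exists z.
by rewrite !scalerA mulrC.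
Qed.

(** The scalar function [v h] is bounded, so its range is relatively compact, and so is that range
    multiplied by the fixed vector [y]. *)
Lemma HvK_add_rank1 f h (y : F) : HvK U v f -> Hv U v h ->
  HvK U v (f + (fun z => h z *: y)).
Proof.
move=> [Hf cf] Hh; split; first by apply: HvD => //; exact: HvZl.
have ch : precompact [set a *: y | a in [set ((v z)%:C%C *: h z) | z in U]].
  apply: precompact_scale_vec; apply: (bounded_precompact (wnorm U v h)).
  by move=> _ [z Uz <-]; rewrite rnormZr gtr0_norm ?vpos// le_wnorm.
apply: precompact_subset (precompactD _ _ _ cf ch) => _ [z Uz <-].
exists ((v z)%:C%C *: f z), (((v z)%:C%C *: h z) *: y); split.
- by exists z.
- by exists ((v z)%:C%C *: h z) => //; exists z.
- by rewrite scalerDr; congr (_ + _); rewrite scalerA.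
Qed.

End weighted.

(** * Rank-one perturbation and property beta *)

Section perturbation.
Context {R : realType} {E F : normedModType R[i]} {U : set E} {v : E -> R}.
Hypothesis vpos : forall z, U z -> 0 < v z.

(** For [P] inside the dual ball this says that the norm is the supremum of the moduli over [P],
    with supremum 0 for an empty family. *)
Definition norming (P : set (F -> R[i]^o)) := forall (x : F) (C : R), 0 <= C ->
  (forall phi, P phi -> rnorm (phi x) <= C) -> rnorm x <= C.

(* Along y the values of phi \o f are replaced by (1 + e) h; since the other
   functionals of P see only a fraction r of this change, phi dominates. *)
Lemma rank_one_perturbation (P : set (F -> R[i]^o)) (phi : F -> R[i]^o)
    (y : F) (f : E -> F) (h : E -> R[i]^o) (M r d e : R) :
  norming P -> (forall psi, P psi -> dual_ball psi) -> P phi ->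
  rnorm y = 1 -> phi y = 1 ->
  (forall psi, P psi -> psi <> phi -> rnorm (psi y) <= r) ->
  HvK U v f -> wnorm U v f <= M -> Hv U v h -> 0 <= e ->
  wnorm U v (h - (phi \o f)) <= d ->
  M + r * (d + e * wnorm U v h) <= (1 + e) * wnorm U v h ->
  exists f0, [/\ HvK U v f0, wnorm U v (f - f0) <= d + e * wnorm U v h,
    forall z, U z -> v z * rnorm (f0 z) <= (1 + e) * wnorm U v h &
    forall z, U z -> v z * rnorm (h z) = wnorm U v h ->
      v z * rnorm (f0 z) = (1 + e) * wnorm U v h].
Proof.
move=> nP bP Pphi y1 phiy hr Kf fM Hh e0 hd hM.
have Hf := Kf.1.
have Hg : Hv U v (phi \o f) by have [] := Hv_comp_dual vpos phi f (bP _ Pphi) Hf.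
(* Since [phi y = 1], adding [u] times [y] to [f] turns [phi \o f] into [(1 + e) h]. *)
pose u : E -> R[i]^o := (h - (phi \o f)) + e%:C%C *: h.
have Hhg : Hv U v (h - (phi \o f)) by exact: HvB.
have Heh : Hv U v (e%:C%C *: h) by exact: HvZ.
have Hu : Hv U v u by exact: HvD.
have wh0 : 0 <= wnorm U v h by exact: wnorm_ge0.
have ud : wnorm U v u <= d + e * wnorm U v h.
  apply: (le_trans (wnormD_le vpos _ _ Hhg Heh)); apply: lerD => //.
  by apply: (le_trans (wnormZ_le _ _ _ Hh)) => //; rewrite ger0_norm.
pose f0 := f + (fun z => u z *: y).
have Kf0 : HvK U v f0 by exact: HvK_add_rank1.
have phif0 z : phi (f0 z) = (1 + e)%:C%C *: h z.
  have [[lphi _] _] := bP _ Pphi.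
  rewrite /f0 -[(f + _) z]/(f z + u z *: y) linear_fctD// linear_fctZ// phiy.
  rewrite /u -[(_ + _) z]/(h z - phi (f z) + e%:C%C *: h z).
  rewrite rmorphD/= /GRing.scale/=; ring.
have f0le z : U z -> v z * rnorm (f0 z) <= (1 + e) * wnorm U v h.
  move=> Uz; have vz := vpos z Uz.
  rewrite mulrC -ler_pdivlMr//; apply: nP => [|psi Ppsi].
    by rewrite divr_ge0 ?mulr_ge0 ?addr_ge0 ?(ltW vz).
  rewrite ler_pdivlMr// mulrC; have [->|psiphi] := pselect (psi = phi).
    rewrite phif0 rnormZr ger0_norm ?addr_ge0// mulrCA ler_wpM2l ?addr_ge0//.
    exact: le_wnorm.
  (* Another [psi] sees at most [M] from [f] and [r] times the norm of [u] from the correction. *)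
  apply: le_trans hM; have [[lpsi _] _] := bP _ Ppsi.
  rewrite /f0 -[(f + _) z]/(f z + u z *: y) linear_fctD// linear_fctZ//.
  rewrite (@le_trans _ _ (v z * (rnorm (f z) + rnorm (u z) * rnorm (psi y))))//.
    rewrite ler_pM2l// (le_trans (rnormD _ _))// lerD//.
      exact: dual_ball_le (bP _ Ppsi).
    by rewrite -(rnormZ (u z) (psi y)).
  rewrite mulrDr lerD//; first exact: le_trans (le_wnorm _ _ Hf Uz) fM.
  have psir := hr _ Ppsi psiphi.
  have r0 : 0 <= r by exact: le_trans (rnorm_ge0 _) psir.
  rewrite mulrA mulrC ler_pM ?rnorm_ge0 ?mulr_ge0 ?rnorm_ge0 ?(ltW vz)//.
  exact: le_trans (le_wnorm _ _ Hu Uz) ud.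
exists f0; split=> //.
- have -> : f - f0 = - (fun z => u z *: y) by rewrite /f0 opprD addrA subrr add0r.
  rewrite wnormN; apply: wnorm_le => [|z Uz].
    by apply: le_trans ud; exact: wnorm_ge0.
  rewrite rnormZ y1 mulr1; exact: le_trans (le_wnorm _ _ Hu Uz) ud.
(* Where [h] attains its norm, [phi] alone gives the lower bound. *)
- move=> z Uz hz; apply/eqP; rewrite eq_le f0le//= -hz mulrCA.
  rewrite ler_pM2l ?vpos// -(ger0_norm (addr_ge0 ler01 e0)).
  rewrite -rnormZr -phif0; exact: dual_ball_le (bP _ Pphi).
Qed.

(** The scalar property is applied to the normalised [ys i \o f] with the same [lambda] and [z], so
    [lambda0], [z0] and the estimate between evaluations carry over; the perturbed mapping is
    finally divided by its norm [1 + e]. *)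
Lemma WHBPB_property_beta : WHBPB U v (Hv (F := R[i]^o) U v) ->
  property_beta F -> WHBPB U v (HvK (F := F) U v).
Proof.
move=> bpb [I [y [ys [rho [/andP[rho0 rho1] hys hrho hnorm]]]]] eps /andP[eps0 eps1].
pose P : set (F -> R[i]^o) := range ys.
have bys i : dual_ball (ys i).
  by have [dy y1 _ _] := hys i; split=> //; rewrite y1.
have bP psi : P psi -> dual_ball psi by move=> [i _ <-].
have nP : norming P.
  move=> x C C0 xC; rewrite hnorm.
  have [[i _]|I0] := pselect ([set: I] !=set0); last first.
    have -> : [set: I] = set0 by apply/eqP/negP => /negP/set0P.
    by rewrite image_set0 sup0.
  apply: ge_sup; first by exists (rnorm (ys i x)), i.
  by move=> _ [j _ <-]; apply: xC; exists j.
(* With [e = eps / 4] below, [2 * e1 = (1 - rho) * e], so [rho * (2 * e1 + e) <= e] as domination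
   requires; the total error [2 * e1 + 2 * e] is below [eps]. *)
pose e1 : R := (1 - rho) * eps / 8.
have e1E : e1 * 8 = (1 - rho) * eps by rewrite /e1; lra.
have e1p : 0 < e1 by rewrite /e1 divr_gt0// mulr_gt0// subr_gt0.
have rhoe : 0 <= rho * eps by rewrite mulr_ge0// ltW.
have e1lt : e1 < 1 by lra.
have e1b : 0 < e1 < 1 by rewrite e1p e1lt.
have [eta /andP[eta0 etae] H] := bpb e1 e1b.
exists eta; first by rewrite eta0/=; lra.
move=> f lambda z Kf f1 l1 Uz fz; have Hf := Kf.1; have vz := vpos z Uz.
have [i gz] : exists i, v z * rnorm (ys i (f z)) > 1 - eta.
  apply: contrapT => noi; move: fz; apply/negP; rewrite -leNgt mulrC -ler_pdivlMr//.
  apply: nP => [|_ [i _ <-]]; first by rewrite divr_ge0 ?ltW//; lra.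
  rewrite ler_pdivlMr// mulrC leNgt; apply/negP => gz; apply: noi.
  by exists i.
have [_ _ y1 ysy] := hys i.
pose g : E -> R[i]^o := ys i \o f.
have [Hg g1] := Hv_comp_dual vpos _ _ (bys i) Hf; rewrite -/g f1 in Hg g1.
set G := wnorm U v g in g1.
have gG : 1 - eta < G by exact: lt_le_trans gz (le_wnorm _ _ Hg Uz).
have G0 : 0 < G by lra.
pose g' : E -> R[i]^o := G^-1%:C%C *: g.
have Hg' : Hv U v g' by exact: HvZ.
have g'1 : wnorm U v g' = 1 by rewrite wnormZ ?invr_gt0// mulVf// gt_eqF.
(* As [G <= 1], dividing by [G] does not decrease the value at [z]. *)
have g'z : v z * rnorm (g' z) > 1 - eta.
  rewrite [X in rnorm X]/(G^-1%:C%C *: g z) rnormZr gtr0_norm ?invr_gt0//.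
  apply: (lt_le_trans gz); rewrite mulrCA ler_peMl ?invf_ge1//.
  by rewrite mulr_ge0 ?rnorm_ge0// ltW.
have [g0 [l0 [z0 [[[Hg0 g01] l01 Uz0] [g0z0 gg0 Glt]]]]] :=
  H g' lambda z Hg' g'1 l1 Uz g'z.
pose e : R := eps / 4.
(* One [e1] comes from [g0], the other from normalising: [g' - g] has norm at most
   [1 - G < eta < e1]. *)
have gd : wnorm U v (g0 - g) <= 2 * e1.
  have -> : g0 - g = - (g' - g0) + (g' - g) by rewrite opprB addrA subrK.
  apply: (le_trans (wnormD_le vpos _ _ _ _)).
  - by rewrite -scaleN1r; apply: HvZ; exact: HvB.
  - exact: HvB.
  rewrite wnormN.
  suff : wnorm U v (g' - g) <= eta by lra.
  have -> : g' - g = (G^-1 - 1)%:C%C *: g.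
    by rewrite rmorphB/= scalerBl scale1r.
  apply: (le_trans (wnormZ_le _ _ _ Hg)) => //.
  rewrite -/G ger0_norm ?subr_ge0 ?invf_ge1// mulrBl mulVf ?gt_eqF// mul1r.
  lra.
have e0 : 0 <= e by rewrite /e; lra.
have hM : 1 + rho * (2 * e1 + e * wnorm U v g0) <= (1 + e) * wnorm U v g0.
  rewrite g01 !mulr1; have rhoe1 : rho * e1 <= e1 by rewrite ler_piMl// ltW.
  rewrite /e; lra.
have ysr psi : P psi -> psi <> ys i -> rnorm (psi (y i)) <= rho.
  by move=> [j _ <-] ji; apply: hrho => ij; apply: ji; rewrite ij.
have f1' : wnorm U v f <= 1 by rewrite f1.
have Pi : P (ys i) by exists i.
have [f0 [Kf0 ff0 f0le f0z]] := rank_one_perturbation P (ys i) (y i) f g0 1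
  rho (2 * e1) e nP bP Pi y1 ysy ysr Kf f1' Hg0 e0 gd hM.
have Hf0 := Kf0.1; rewrite g01 !mulr1 in ff0 f0le.
have f0z0 := f0z z0 Uz0; rewrite g01 mulr1 in f0z0; have {}f0z0 := f0z0 g0z0.
have ep : 0 < 1 + e by lra.
have f01 : wnorm U v f0 = 1 + e.
  rewrite -f0z0; apply: wnorm_eq => // w Uw; rewrite f0z0; exact: f0le.
exists ((1 + e)^-1%:C%C *: f0), l0, z0; split.
  split=> //; split; first exact: HvKZ.
  by rewrite wnormZ ?invr_gt0// f01 mulVf// gt_eqF.
split.
- rewrite [X in rnorm X]/((1 + e)^-1%:C%C *: f0 z0) rnormZr.
  by rewrite gtr0_norm ?invr_gt0// mulrCA f0z0 mulVf// gt_eqF.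
(* Renormalising [f0] costs [(1 - (1 + e)^-1) * (1 + e) = e]. *)
- have -> : f - (1 + e)^-1%:C%C *: f0 = (f - f0) + (1 - (1 + e)^-1)%:C%C *: f0.
    by rewrite rmorphB/= scalerBl scale1r addrA subrK.
  apply: (le_lt_trans (wnormD_le vpos _ _ _ _)).
  + exact: HvB.
  + exact: HvZ.
  have := wnormZ_le vpos (1 - (1 + e)^-1) f0 Hf0.
  rewrite f01 ger0_norm; last by rewrite subr_ge0 invf_le1//; lra.
  rewrite mulrBl mulVf ?gt_eqF// mul1r; move: ff0; rewrite /e; lra.
- by apply: (lt_le_trans Glt); lra.
Qed.

End perturbation.

(** * Norm attainment under property quasi-beta *)

Section quasi_beta.
Context {R : realType} {E F : normedModType R[i]} {U : set E} {v : E -> R}.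
Hypothesis vpos : forall z, U z -> 0 < v z.

Lemma ptws_closure_near (A : set (F -> R[i]^o)) (psi : F -> R[i]^o) (k : F)
    (d : R) : closure (A : set {ptws F -> R[i]^o}) psi -> 0 < d ->
  exists2 phi, A phi & rnorm (phi k - psi k) < d.
Proof.
move=> clA d0.
have nb : nbhs (psi k) [set a : R[i]^o | rnorm (a - psi k) < d].
  apply/nbhs_ballP; exists d%:C%C; first by rewrite /= ltcR.
  by move=> a; rewrite -ball_normE /= distrC -rnormE ltcR.
have := @proj_continuous F (fun _ => R[i]^o : topologicalType) k psi _ nb.
by move=> /clA[phi [Aphi phik]]; exists phi.
Qed.

(** The norm attains its maximum on the compact closure of the range, even if [v f] does not attain
    its norm on [U]. *)
Lemma HvK_max_value (f : E -> F) (z : E) : HvK U v f -> U z ->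
  exists2 k, closure [set (v z)%:C%C *: f z | z in U] k & wnorm U v f <= rnorm k.
Proof.
move=> [Hf]; rewrite precompactE => cK Uz.
set K := closure _ in cK *.
have K0 : K !=set0.
  by exists ((v z)%:C%C *: f z); apply: subset_closure; exists z.
have cn : continuous (@rnorm R F).
  move=> x; apply/cvgrPdist_lt => e e0.
  have : \forall y \near x, `|x - y| < e%:C%C.
    by apply: (cvgr_dist_lt (fun x => x)) => //; rewrite ltcR.
  apply: filterS => y; rewrite -rnormE ltcR; apply: le_lt_trans.
  have := rnormD (x - y) y; have := rnormD (y - x) x.
  rewrite !subrK -opprB rnormN ler_norml; lra.
have [k Kk kmax] := compact_EVT_max K0 cK (continuous_subspaceT cn).
exists k; first by rewrite inE in Kk.
apply: wnorm_le => [|w Uw]; first exact: rnorm_ge0.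
have := kmax ((v w)%:C%C *: f w); rewrite rnormZr gtr0_norm ?vpos//; apply.
by rewrite inE; apply: subset_closure; exists w.
Qed.

(** An extreme functional norming [k] supplies the set [Ae] and the bound [r < 1] before any
    accuracy is fixed; [phi] in [Ae] can then be chosen as close to norming [k] as [r] demands. *)
Lemma norm_dense_property_quasi_beta :
  norm_dense_in U v (HvNA (F := R[i]^o) U v) (Hv (F := R[i]^o) U v) ->
  property_quasi_beta F ->
  norm_dense_in U v (HvKNA (F := F) U v) (HvK (F := F) U v).
Proof.
move=> dense [A [sigma [rho [[Asph sigma1] Asigma Arho Aext]]]] f Kf eps eps0.
have Hf := Kf.1; set M := wnorm U v f.
(* The mapping approximating 0 attains its norm at a point of [U]. *)
have [z1 Uz1] : U !=set0.
  have H0 : Hv (F := R[i]^o) U v 0.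
    split=> [z _|]; first exact: (differentiable_cst 0).
    by exists 0 => _ [z _ <-]; rewrite [X in rnorm X]/0 rnorm0 mulr0.
  by have [g [_ [z Uz _]] _] := dense _ H0 1 ltr01; exists z.
have [M0|M0] := leP M 0.
  exists f.
    split=> //; split=> //; exists z1 => //; apply/eqP; rewrite eq_le le_wnorm//=.
    by rewrite (le_trans M0)// mulr_ge0 ?rnorm_ge0// ltW// vpos.
  rewrite subrr; apply: le_lt_trans eps0; apply: wnorm_le => // z Uz.
  by rewrite [X in rnorm X]/(0 : F) rnorm0 mulr0.
have bA phi : A phi -> dual_ball phi.
  by move=> /Asph[dphi phi1]; split=> //; rewrite phi1.
have nearA (x : F) : exists Ae, [/\ Ae `<=` A, sup [set rho ys | ys in Ae] < 1 &
    forall d : R, 0 < d -> exists2 phi, Ae phi & rnorm x - d < rnorm (phi x)].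
  have [es ees xes] := extreme_norming x.
  have [Ae [t [AeA t1 cl srho]]] := Aext _ ees.
  exists Ae; split=> // d d0.
  have [phi Aephi phix] := ptws_closure_near _ _ x _ cl d0.
  exists phi => //.
  have tes : rnorm ((t *: es) x) = rnorm (es x).
    by rewrite [X in rnorm X]/(t *: es x) rnormZ rnorm_unit// mul1r.
  have := rnormD (phi x) ((t *: es) x - phi x).
  by rewrite subrKC tes -opprB rnormN; lra.
have nA : norming A.
  move=> x C C0 xC; apply/ler_addgt0Pr => d d0.
  have [Ae [AeA _ /(_ d d0)[phi /AeA/xC]]] := nearA x; lra.
have [k clk Mk] := HvK_max_value f z1 Kf Uz1.
have [Ae [AeA srho neark]] := nearA k.
(* The maximum with 0 keeps [r] nonnegative even if the values of [rho] are negative. *)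
pose r := Num.max 0 (sup [set rho ys | ys in Ae]).
have r0 : 0 <= r by rewrite le_max lexx.
have r1 : r < 1 by rewrite gt_max ltr01.
(* [L = e * M] is at most [M] and [eps / 4]. With [d * 6 = (1 - r) * L], the norm [H] of [h] is
   within [2 * d] of [M], so [e * H] is between [L / 2] and [2 * L]. Then
   [3 * d <= (1 - r) * (e * H)] gives domination, and [d + e * H < 4 * L] the distance. *)
pose e : R := Num.min 1 (eps / (4 * M)).
have e0 : 0 < e by rewrite lt_min ltr01 divr_gt0// mulr_gt0.
pose L := e * M.
have L0 : 0 < L by rewrite mulr_gt0.
have LM : L <= M by rewrite ler_piMl ?(ltW M0)// ge_min lexx.
have Leps : L * 4 <= eps.
  have : e <= eps / (4 * M) by rewrite ge_min lexx orbT.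
  by rewrite ler_pdivlMr ?mulr_gt0// /L; lra.
pose d := (1 - r) * L / 6.
have dE : d * 6 = L - r * L by rewrite /d; lra.
have rL0 : 0 <= r * L by rewrite mulr_ge0// ltW.
have d0 : 0 < d by rewrite divr_gt0// mulr_gt0// subr_gt0.
have d2 : 0 < d / 2 by lra.
have [phi Aephi phik] := neark (d / 2) d2.
have Aphi := AeA _ Aephi.
have [Hg gM] := Hv_comp_dual vpos phi f (bA _ Aphi) Hf.
set g := phi \o f in Hg gM.
(* One half of [d] is lost between [k] and a point of the range, the other because [phi] only almost
   norms [k]. *)
have gd : M - d < wnorm U v g.
  have nb : nbhs k [set x : F | rnorm (x - k) < d / 2].
    apply/nbhs_ballP; exists (d / 2)%:C%C; first by rewrite /= ltcR; lra.
    by move=> x; rewrite -ball_normE /= distrC -rnormE ltcR.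
  have [_ [[z Uz <-] /= zk]] := clk _ nb.
  have [[lphi _] _] := bA _ Aphi.
  have := dual_ball_le phi (k - (v z)%:C%C *: f z) (bA _ Aphi).
  have := rnormD (phi (k - (v z)%:C%C *: f z)) (phi ((v z)%:C%C *: f z)).
  rewrite -linear_fctD// subrK [phi (_ *: f z)]linear_fctZ// rnormZr.
  rewrite gtr0_norm ?vpos// -[k - _]opprB rnormN.
  have := le_wnorm _ _ Hg Uz; rewrite /g /=; rewrite -/M in Mk; lra.
have [h [Hh [z0 Uz0 hz0]] gh] := dense _ Hg d d0.
have hg : wnorm U v (h - g) <= d by rewrite -opprB wnormN ltW.
set H := wnorm U v h in hz0.
have HM : H < M + d.
  have := wnormD_le vpos _ _ (HvB vpos _ _ Hh Hg) Hg.
  rewrite subrK -/H; move: gM gh; rewrite -/M -opprB wnormN; lra.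
have MH : M - 2 * d < H.
  have := wnormD_le vpos _ _ (HvB vpos _ _ Hg Hh) Hh.
  by rewrite subrK -/H; lra.
have eH1 : L <= 2 * (e * H).
  by rewrite /L mulrCA ler_pM2l//; lra.
have eH2 : e * H <= 2 * L by rewrite /L mulrCA ler_pM2l//; lra.
have hM : M + r * (d + e * H) <= (1 + e) * H.
  have : r * d <= d by rewrite ler_piMl// ltW.
  have : (1 - r) * L <= (1 - r) * (2 * (e * H)) by rewrite ler_wpM2l// subr_ge0 ltW.
  lra.
have rsig psi : A psi -> psi <> phi -> rnorm (psi (sigma phi)) <= r.
  move=> Apsi psiphi.
  have [|le1 _] := Arho phi psi Aphi Apsi; first by move=> pp; apply: psiphi.
  apply: (le_trans le1); rewrite le_max; apply/orP; right.
  apply: ub_le_sup; last by exists phi.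
  (* [Arho] bounds [rho chi] through a second member of [A]: [psi] if [chi = phi], and [phi]
     otherwise. *)
  exists 1 => _ [chi /AeA Achi <-]; apply: ltW.
  have [e1|ne] := pselect (chi = phi).
    by have [|] := Arho chi psi Achi Apsi; [rewrite e1 => pp; exact: psiphi|].
  by have [] := Arho chi phi Achi Aphi ne.
have [f0 [Kf0 ff0 f0le f0z]] := rank_one_perturbation vpos A phi (sigma phi) f h M
  r d e nA bA Aphi (sigma1 _ Aphi) (Asigma _ Aphi) rsig Kf (lexx _) Hh (ltW e0) hg hM.
exists f0.
  split=> //; split; first exact: Kf0.1.
  exists z0 => //; apply/esym; apply: wnorm_eq => //; first exact: Kf0.1.
  by move=> w Uw; rewrite (f0z _ Uz0 hz0); exact: f0le.
by apply: (le_lt_trans ff0); rewrite -/H; lra.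
Qed.

End quasi_beta.

Theorem proposition3p4 (R : realType) (E : completeNormedModType R[i])
    (U : set E) (v : E -> R) (openU : open U) (weight_v : weight U v) :
  (WHBPB U v (Hv (F := R[i]^o) U v) ->
   forall F : completeNormedModType R[i], property_beta F ->
     WHBPB U v (HvK (F := F) U v))
  /\
  (norm_dense_in U v (HvNA (F := R[i]^o) U v) (Hv (F := R[i]^o) U v) ->
   forall F : completeNormedModType R[i], property_quasi_beta F ->
     norm_dense_in U v (HvKNA (F := F) U v) (HvK (F := F) U v)).
Proof.
have [_ vpos] := weight_v.
split=> [bpb F|dense F].
  exact: WHBPB_property_beta.
exact: norm_dense_property_quasi_beta.
Qed.
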